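(* There is an absolute constant $C>0$ such that the following holds. For any $\varepsilon>0$ there is a $\delta=\delta(\varepsilon)\ge 2^{-C/\varepsilon}$ (i.e. $\delta=2^{-O(1/\varepsilon)}$) such that for every bipartite graph $G$ with bipartition $X\cup Y$, $|X|=n$ and $|Y|=2n$, if $\mathrm{im}(G)<(1-\varepsilon)n$, then $\log\mathrm{irr}(G)<(1-\delta)n$.
   Context: $\log=\log_2$. An induced matching of $G$ is an induced subgraph that is a matching; $\mathrm{im}(G)$ is the number of edges in a largest induced matching. A set $X'\subseteq X$ is irredundant if for every $x\in X'$, $N(x)\not\subseteq N(X'\setminus\{x\})$ (with $N(S)=\bigcup_{x\in S}N(x)$); $\mathrm{irr}(G)$ is the number of irredundant subsets of $X$. *)

(* Defs.v *)
From mathcomp Require Import all_boot all_order all_algebra.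
From mathcomp Require Import reals exp.

Set Implicit Arguments.
Unset Strict Implicit.
Unset Printing Implicit Defensive.

Import Order.TTheory GRing.Theory Num.Theory.

Definition simple_graph (V : finType) (e : rel V) : Prop :=
  symmetric e /\ irreflexive e.

Definition bipartition (V : finType) (e : rel V) (X Y : {set V}) : Prop :=
  [/\ X :|: Y = [set: V],
      [disjoint X & Y],
      {in X &, forall u v, ~~ e u v}
    & {in Y &, forall u v, ~~ e u v}].

Definition nbr (V : finType) (e : rel V) (x : V) : {set V} := [set y | e x y].

Definition nbrs (V : finType) (e : rel V) (S : {set V}) : {set V} :=
  \bigcup_(x in S) nbr e x.

Definition induced_edges (V : finType) (e : rel V) (S : {set V}) :
    {set {set V}} :=
  [set [set u; v] | u in S, v in S & e u v].

(* The induced subgraph on S is a matching when its edges are pairwise disjoint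
   and cover S. *)
Definition induced_matching (V : finType) (e : rel V) (S : {set V}) : bool :=
  partition (induced_edges e S) S.

Definition im (V : finType) (e : rel V) : nat :=
  (\max_(S : {set V} | induced_matching e S) #|induced_edges e S|)%N.

Definition irredundant (V : finType) (e : rel V) (A : {set V}) : bool :=
  [forall x in A, ~~ (nbr e x \subset nbrs e (A :\ x))].

Definition irr (V : finType) (e : rel V) (X : {set V}) : nat :=
  #|[set A : {set V} | (A \subset X) && irredundant e A]|.

Definition log2 (R : realType) (x : R) : R := (ln x / ln 2)%R.

(* Main.v *)
Require Import Defs.
From mathcomp Require Import all_boot all_order all_algebra.
From mathcomp Require Import reals sequences exp.
From mathcomp Require Import ring lra zify.

(* Choose A uniformly among the subsets of X.  If A is irredundant, then every
   x in A has a private neighbour, that is, some y in Y with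
   A :&: N(y) = [set x].

   First delete a set W of at most n/(4N) vertices of X, with N about 1/eps,
   so that with M(y) = N(y) \ W every x lies in few of the sets M(y) of size
   at most 2D ("low" y), while among the y with |M(y)| > 2D ("high" y) every
   family Q contains at least |Q|/(L+1) members with disjoint D-subsets of
   their M(y).  Vertices x having some y with M(y) = [set x] span an induced
   matching, so at least n/(2N) vertices x have no such y and moreover satisfy
   sum_{low y ~ x} 2^(1-|M(y)|) <= 8N.  By Harris' inequality each of these is
   "blocked" with probability at least p = 2^(-O(N)): x is in A, but no low y
   is private to it.  Many of them depend on disjoint sets of coordinates, so
   except with exponentially small probability there are linearly many blocked
   x; each of them must use its own high private neighbour.  But linearly many
   high y with |A :&: M(y)| <= 1 are exponentially unlikely, by an
   exponential-moment bound over the families with disjoint D-subsets.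

   The resulting estimate 2 exp(-eta n) is useless when n < 2/eta = 2^(O(N)); in
   that range a single blocked x, with W empty and every y low, suffices. *)

Set Implicit Arguments.
Unset Strict Implicit.
Unset Printing Implicit Defensive.

Import Order.TTheory GRing.Theory Num.Theory.
Local Open Scope ring_scope.

(** * Averages over random subsets *)

(* The expectation of [f (A :|: S)], for [S] a uniformly random set of elements
   of the duplicate-free sequence [s]. *)
Fixpoint avg (R : realFieldType) (V : finType) (s : seq V)
    (f : {set V} -> R) (A : {set V}) : R :=
  if s is x :: s' then (avg s' f A + avg s' f (x |: A)) / 2 else f A.

Definition depends_on (R : Type) (V : finType) (B : {set V})
    (f : {set V} -> R) : Prop :=
  forall A A' : {set V}, A :&: B = A' :&: B -> f A = f A'.

Definition increasing (R : realFieldType) (V : finType)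
    (f : {set V} -> R) : Prop :=
  forall A A' : {set V}, A \subset A' -> f A <= f A'.

Lemma eq_avg (R : realFieldType) (V : finType) (s : seq V)
    (f g : {set V} -> R) (A : {set V}) : f =1 g -> avg s f A = avg s g A.
Proof.
by move=> efg; elim: s A => [|x s IH] A /=; rewrite ?efg ?IH.
Qed.

Lemma ler_avg (R : realFieldType) (V : finType) (s : seq V)
    (f g : {set V} -> R) (A : {set V}) :
  (forall A', f A' <= g A') -> avg s f A <= avg s g A.
Proof.
move=> lefg; elim: s A => [|x s IH] A //=.
by rewrite ler_pM2r ?invr_gt0 // lerD.
Qed.

Lemma avg_cst (R : realFieldType) (V : finType) (s : seq V) (c : R)
    (A : {set V}) : avg s (fun=> c) A = c.
Proof. by elim: s A => [|x s IH] A //=; rewrite !IH; lra. Qed.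

Lemma avgD (R : realFieldType) (V : finType) (s : seq V)
    (f g : {set V} -> R) (A : {set V}) :
  avg s (fun A' => f A' + g A') A = avg s f A + avg s g A.
Proof. by elim: s A => [|x s IH] A //=; rewrite !IH; lra. Qed.

Lemma avgZ (R : realFieldType) (V : finType) (s : seq V) (c : R)
    (f : {set V} -> R) (A : {set V}) :
  avg s (fun A' => c * f A') A = c * avg s f A.
Proof. by elim: s A => [|x s IH] A //=; rewrite !IH; lra. Qed.

Lemma avg_sum (R : realFieldType) (V : finType) (s : seq V) (I : Type)
    (r : seq I) (P : pred I) (f : I -> {set V} -> R) (A : {set V}) :
  avg s (fun A' => \sum_(i <- r | P i) f i A') A
  = \sum_(i <- r | P i) avg s (f i) A.
Proof.
elim: r => [|i r IH].
  by rewrite big_nil -[RHS](avg_cst s 0 A); apply: eq_avg => A'; rewrite big_nil.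
rewrite big_cons -IH -(fun_if (fun z => z)).
case Pi: (P i).
  by rewrite -avgD; apply: eq_avg => A'; rewrite big_cons Pi.
by apply: eq_avg => A'; rewrite big_cons Pi.
Qed.

(** Sorting the subsets by whether they contain the head of [s] reproduces the recursion of [avg].
    This is the passage from counting to probability. *)
Lemma sum_subset_avg (R : realFieldType) (V : finType) (s : seq V)
    (f : {set V} -> R) (A0 : {set V}) :
  uniq s ->
  \sum_(A : {set V} | A \subset [set x in s]) f (A0 :|: A)
  = 2 ^+ size s * avg s f A0.
Proof.
elim: s A0 => [|x s IH] A0 /=.
  move=> _; rewrite mul1r (big_pred1 set0) ?setU0 // => A /=.
  by rewrite (_ : [set x in [::]] = set0) ?subset0 //; apply/setP=> x; rewrite !inE.
case/andP=> xs us.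
have xA (A : {set V}) : A \subset [set z in s] -> x \notin A.
  by move=> sA; apply: contra xs => /(subsetP sA); rewrite inE.
have sxA (A : {set V}) :
    (A \subset [set z in x :: s]) = (A :\ x \subset [set z in s]).
  rewrite subDset (_ : [set z in x :: s] = x |: [set z in s]) //.
  by apply/setP=> z; rewrite !inE.
rewrite (bigID (fun A : {set V} => x \in A)) /=.
have -> : \sum_(A : {set V} | (A \subset [set z in x :: s]) && (x \in A))
              f (A0 :|: A)
        = \sum_(A : {set V} | A \subset [set z in s]) f ((x |: A0) :|: A).
  rewrite (reindex_onto (fun A => x |: A) (fun A => A :\ x)) /=; last first.
    by move=> A /andP[_ xinA]; rewrite setD1K.
  apply: eq_big => [A|A _]; last by rewrite setUCA setUA.
  rewrite sxA setU11 andbT.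
  apply/andP/idP => [[sA /eqP <-] //|sA].
  by rewrite setU1K ?xA.
have -> : \sum_(A : {set V} | (A \subset [set z in x :: s]) && (x \notin A))
              f (A0 :|: A)
        = \sum_(A : {set V} | A \subset [set z in s]) f (A0 :|: A).
  apply: eq_bigl => A; rewrite sxA; apply/andP/idP => [[sA nx]|sA].
    by rewrite (setDidPl _) // in sA; rewrite disjoint_sym disjoints1.
  split; last exact: xA.
  exact: subset_trans (subsetDl _ _) sA.
by rewrite !IH // exprS; lra.
Qed.

Lemma increasing_avg (R : realFieldType) (V : finType) (s : seq V)
    (f : {set V} -> R) : increasing f -> increasing (avg s f).
Proof.
move=> incf; elim: s => [//|x s IH] A A' sAA' /=.
by rewrite ler_pM2r ?invr_gt0 // lerD ?IH // setUS.
Qed.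

(** By induction on [s]: splitting on the head reduces the claim to (a1 - a0) (b1 - b0) >= 0, where
    a0 <= a1 and b0 <= b1 are the averages of [f] and of [g] without and with the head. *)
Lemma harris (R : realFieldType) (V : finType) (s : seq V)
    (f g : {set V} -> R) (A : {set V}) :
  increasing f -> increasing g ->
  avg s f A * avg s g A <= avg s (fun A' => f A' * g A') A.
Proof.
move=> incf incg; elim: s A => [//|x s IH] A /=.
have sA : A \subset x |: A by exact: subsetUr.
have := increasing_avg s incf sA; have := increasing_avg s incg sA.
have := IH A; have := IH (x |: A).
nra.
Qed.

Lemma harris_prod (R : realFieldType) (V : finType) (s : seq V) (I : Type)
    (r : seq I) (P : pred I) (f : I -> {set V} -> R) (A : {set V}) :
  (forall i, P i -> increasing (f i)) -> (forall i A', 0 <= f i A') ->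
  \prod_(i <- r | P i) avg s (f i) A
  <= avg s (fun A' => \prod_(i <- r | P i) f i A') A.
Proof.
move=> incf f0.
elim: r => [|i r IH].
  by rewrite big_nil -[leLHS](avg_cst s 1 A); apply: ler_avg => A'; rewrite big_nil.
rewrite big_cons; case Pi: (P i); last first.
  by rewrite (le_trans IH) //; apply: ler_avg => A'; rewrite big_cons Pi.
have incp : increasing (fun A' => \prod_(j <- r | P j) f j A').
  move=> B B' sB; apply: ler_prod => j Pj.
  by rewrite f0 incf.
apply: le_trans (_ : _ <= avg s (f i) A *
   avg s (fun A' => \prod_(j <- r | P j) f j A') A) _.
  rewrite ler_wpM2l // -[leLHS](avg_cst s 0 A); exact: ler_avg.
apply: le_trans (harris _ _ (incf _ Pi) incp) _.
by apply: ler_avg => A'; rewrite big_cons Pi.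
Qed.

Lemma depends_on_avg (R : realFieldType) (V : finType) (s : seq V)
    (B : {set V}) (f : {set V} -> R) :
  depends_on B f -> depends_on B (avg s f).
Proof.
move=> depf; elim: s => [//|x s IH] A A' eA /=.
by rewrite (IH _ _ eA) (IH (x |: A) (x |: A')) // !setIUl eA.
Qed.

(** At each coordinate [x], disjointness leaves at least one of [f], [g] indifferent to [x]. That
    factor has the same average on both halves and comes out. *)
Lemma avgM_disjoint (R : realFieldType) (V : finType) (s : seq V)
    (B B' : {set V}) (f g : {set V} -> R) (A : {set V}) :
  depends_on B f -> depends_on B' g -> [disjoint B & B'] ->
  avg s (fun A' => f A' * g A') A = avg s f A * avg s g A.
Proof.
move=> df dg dBB'; elim: s A => [//|x s IH] A /=; rewrite !IH.
have ign (C : {set V}) (k : {set V} -> R) : depends_on C k -> x \notin C ->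
    avg s k (x |: A) = avg s k A.
  move=> dk xC; apply: (depends_on_avg s dk).
  rewrite setIUl (_ : [set x] :&: C = set0) ?set0U //.
  by apply/eqP; rewrite setI_eq0 disjoints1.
have [xB|xB] := boolP (x \in B).
  have xB' : x \notin B' by rewrite (disjointFr dBB').
  by rewrite (ign _ _ dg xB'); lra.
by rewrite (ign _ _ df xB); lra.
Qed.

Lemma avg_prod_disjoint (R : realFieldType) (V I : finType) (s : seq V)
    (J : {set I}) (B : I -> {set V}) (f : I -> {set V} -> R) (A : {set V}) :
  (forall i, depends_on (B i) (f i)) ->
  {in J &, forall i j, i != j -> [disjoint B i & B j]} ->
  avg s (fun A' => \prod_(i in J) f i A') A = \prod_(i in J) avg s (f i) A.
Proof.
move=> depf; move: {2}_.+1 (ltnSn #|J|) => k; elim: k J => [//|k IH] J leJ dJ.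
have [->|[i iJ]] := set_0Vmem J.
  by rewrite big_set0 -[RHS](avg_cst s 1 A); apply: eq_avg => A'; rewrite big_set0.
rewrite (big_setD1 i) //= -IH; first last.
- by move=> u v; rewrite !inE => /andP[_ uJ] /andP[_ vJ]; apply: dJ.
- by move: leJ; rewrite (cardsD1 i) iJ.
rewrite -(@avgM_disjoint _ _ s (B i) (\bigcup_(j in J :\ i) B j)) //.
- by apply: eq_avg => A'; rewrite (big_setD1 i).
- move=> A1 A2 eA; apply: eq_bigr => j jJ; apply: depf.
  have sj : B j \subset \bigcup_(j in J :\ i) B j by exact: bigcup_sup.
  by rewrite -(setIidPr sj) !setIA eA.
apply: bigcup_disjoint => j; rewrite !inE => /andP[ji jJ].
by apply: dJ; rewrite // eq_sym.
Qed.

Lemma avg_coord (R : realFieldType) (V : finType) (s : seq V) (v : V)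
    (a b : R) (A : {set V}) : v \in s -> v \notin A -> uniq s ->
  avg s (fun A' => if v \in A' then a else b) A = (a + b) / 2.
Proof.
have dep : depends_on [set v] (fun A' : {set V} => if v \in A' then a else b).
  move=> A1 A2 /setP/(_ v); rewrite !inE eqxx !andbT => ->; done.
have noc (t : seq V) (B : {set V}) : v \notin t ->
    avg t (fun A' : {set V} => if v \in A' then a else b) B
    = if v \in B then a else b.
  elim: t B => [//|x t IH] B; rewrite inE negb_or => /andP[vx vt] /=.
  by rewrite !IH // !inE (negPf vx) /=; case: ifP => _; lra.
elim: s A => [//|x s IH] A /=; rewrite inE => /orP[/eqP <-|vs] vA /andP[xs us].
  by rewrite !noc // setU11 (negPf vA); lra.
rewrite !IH //; first by lra.
by rewrite !inE negb_or vA andbT; apply: contraNneq xs => <-.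
Qed.

Lemma avg_prod_coord (R : realFieldType) (V : finType) (X S : {set V})
    (a b : R) : S \subset X ->
  avg (enum X) (fun A => \prod_(v in S) if v \in A then a else b) set0
  = ((a + b) / 2) ^+ #|S|.
Proof.
move=> sSX; rewrite (@avg_prod_disjoint _ _ _ _ _ (fun v => [set v])).
- rewrite -prodr_const; apply: eq_bigr => v vS.
  by rewrite avg_coord ?inE ?mem_enum ?(subsetP sSX) ?enum_uniq.
- move=> v A1 A2 /setP/(_ v); rewrite !inE eqxx !andbT => ->; done.
- by move=> u v _ _ uv; rewrite disjoints1 inE.
Qed.

Lemma prod_coord_card (R : realFieldType) (V : finType) (S A : {set V})
    (c : R) : \prod_(v in S) (if v \in A then c else 1) = c ^+ #|A :&: S|.
Proof.
rewrite -big_mkcondr /= -prodr_const; apply: eq_bigl => v.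
by rewrite !inE andbC.
Qed.

Lemma avg_expr_card (R : realFieldType) (V : finType) (X S : {set V})
    (c : R) : S \subset X ->
  avg (enum X) (fun A => c ^+ #|A :&: S|) set0 = ((c + 1) / 2) ^+ #|S|.
Proof.
move=> sSX; rewrite -(avg_prod_coord c 1 sSX).
by apply: eq_avg => A; rewrite prod_coord_card.
Qed.

(** The binomial theorem, read off the mean of c^|A| for a random subset A of [Y]. *)
Lemma sum_expr_subset (R : realFieldType) (V : finType) (Y : {set V}) (c : R) :
  \sum_(Q : {set V} | Q \subset Y) c ^+ #|Q| = (1 + c) ^+ #|Y|.
Proof.
have := sum_subset_avg (fun A => c ^+ #|A :&: Y|) set0 (enum_uniq Y).
rewrite avg_expr_card // -cardE -exprMn.
have -> : 2 * ((c + 1) / 2) = 1 + c by field.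
move=> <-.
have -> : [set x in enum Y] = Y by apply/setP=> x; rewrite inE mem_enum.
by apply: eq_bigr => Q sQ; rewrite set0U (setIidPl sQ).
Qed.

Lemma avg_meets (R : realFieldType) (V : finType) (X S : {set V}) :
  S \subset X ->
  avg (enum X) (fun A => (A :&: S != set0)%:R) set0 = 1 - (2^-1) ^+ #|S| :> R.
Proof.
move=> sSX; have := avg_prod_coord (0 : R) 1 sSX; rewrite add0r div1r => <-.
rewrite -mulN1r -avgZ -[X in X + _](avg_cst (enum X) (1 : R) set0) -avgD.
apply: eq_avg => A; rewrite prod_coord_card expr0n cards_eq0.
by case: eqP => _ /=; lra.
Qed.

(** * Optimal deletion and packing of disjoint subsets *)

(* Optimality condition for the choice of the deleted set [W] that minimizes
   [L * #|W| + \sum_(y in Y) minn D #|N y :\: W|]: deleting [T] in addition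
   does not pay. *)
Definition balanced (V : finType) (L D : nat) (X Y : {set V})
    (M : V -> {set V}) : Prop :=
  forall Q T : {set V}, Q \subset Y -> T \subset X ->
    (\sum_(y in Q) minn D #|M y|
     <= L * #|T| + \sum_(y in Q) minn D #|M y :\: T|)%N.

Lemma exists_balanced (V : finType) (L D : nat) (X Y : {set V})
    (N : V -> {set V}) :
  exists W : {set V}, [/\ W \subset X, (L * #|W| <= D * #|Y|)%N
    & balanced L D X Y (fun y => N y :\: W)].
Proof.
pose cost (W : {set V}) := (L * #|W| + \sum_(y in Y) minn D #|N y :\: W|)%N.
have [W sWX minW] := @arg_minnP _ set0 (fun W => W \subset X) cost (sub0set X).
exists W; split=> //.
  (* The size bound comes from comparing [W] with the empty set; balance comes below from comparing
     it with [W :|: T]. *)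
  apply: leq_trans (leq_addr _ _) (leq_trans (minW _ (sub0set X)) _).
  rewrite /cost cards0 muln0 add0n mulnC -sum_nat_const.
  by apply: leq_sum => y _; apply: geq_minl.
move=> Q T sQY sTX.
have := minW (W :|: T); rewrite subUset sWX sTX => /(_ isT); rewrite /cost.
rewrite !(big_setID Q (A := Y)) /= (setIidPr sQY).
have -> : (\sum_(y in Q) minn D #|N y :\: (W :|: T)|
          = \sum_(y in Q) minn D #|N y :\: W :\: T|)%N.
  by apply: eq_bigr => y _; rewrite setDDl.
have : (\sum_(y in Y :\: Q) minn D #|N y :\: (W :|: T)|
          <= \sum_(y in Y :\: Q) minn D #|N y :\: W|)%N.
  apply: leq_sum => y _; rewrite leq_min geq_minl /=.
  by apply: leq_trans (geq_minr _ _) (subset_leq_card _); rewrite setDS ?subsetUl.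
have : (#|W :|: T| <= #|W| + #|T|)%N by rewrite cardsU leq_subr.
nia.
Qed.

(** Deleting [x] alone lowers the term of each counted [y] by exactly one, and balance caps this
    saving at [L]. *)
Lemma balanced_low_degree (V : finType) (L D : nat) (X Y : {set V})
    (M : V -> {set V}) (x : V) :
  balanced L D X Y M -> x \in X ->
  (#|[set y in Y | (x \in M y) && (#|M y| <= D)%N]| <= L)%N.
Proof.
move=> balM xX; set Q := [set y in Y | _].
have sQY : Q \subset Y by apply/subsetP => y; rewrite inE => /andP[].
have sxX : [set x] \subset X by rewrite sub1set.
have := balM Q [set x] sQY sxX; rewrite cards1 muln1.
have -> : (\sum_(y in Q) minn D #|M y| =
           #|Q| + \sum_(y in Q) minn D #|M y :\: [set x]|)%N.
  rewrite -sum1_card -big_split /=; apply: eq_bigr => y.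
  rewrite inE => /and3P[_ xMy leD].
  by move: leD; rewrite (cardsD1 x (M y)) xMy; lia.
by lia.
Qed.

(* [T] is to be thought of as a union of disjoint sets [S y \subset M y] of
   size [D], for [y] in [Q]. *)
Definition packable (V : finType) (D : nat) (X : {set V}) (M : V -> {set V})
    (Q : {set V}) : bool :=
  [exists T : {set V}, [&& T \subset X, #|T| == (D * #|Q|)%N
    & [forall A : {set V}, [forall y in Q, #|A :&: M y| <= 1]%N
        ==> (#|A :&: T| <= #|Q|)%N]]].

(** Take [Q'] maximal, with its set [T]. For [y] in [Q] outside [Q'] fewer than [D] elements of
    [M y] avoid [T], since otherwise [y] could be added. So deleting [T] saves at least [D] on each
    such [y], and balance against the price L D |Q'| gives |Q - Q'| <= L |Q'|. *)
Lemma exists_packable (V : finType) (L D : nat) (X Y Q : {set V})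
    (M : V -> {set V}) :
  balanced L (2 * D) X Y M -> (0 < D)%N -> Q \subset Y ->
  {in Q, forall y, M y \subset X} -> {in Q, forall y, 2 * D <= #|M y|}%N ->
  exists2 Q' : {set V}, Q' \subset Q &
    packable D X M Q' && (#|Q| <= L.+1 * #|Q'|)%N.
Proof.
move=> balM D0 sQY MX Mlarge.
have pack0 : packable D X M set0.
  apply/existsP; exists set0; rewrite sub0set !cards0 muln0 eqxx /=.
  by apply/forallP => A; rewrite setI0 cards0 leqnn implybT.
have [Q' /andP[sQ' pQ'] maxQ'] := @arg_maxnP _ set0
  (fun Q' : {set V} => (Q' \subset Q) && packable D X M Q')
  (fun Q' => #|Q'|) (introT andP (conj (sub0set Q) pack0)).
exists Q' => //; rewrite pQ' /=.
have /existsP[T /and3P[sTX /eqP cT /forallP TP]] := pQ'.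
have small y : y \in Q :\: Q' -> (#|M y :\: T| < D)%N.
  rewrite inE => /andP[yQ' yQ]; rewrite ltnNge; apply/negP => leD.
  have [S sS cS] : exists2 S : {set V}, S \subset M y :\: T & #|S| = D.
    exists [set z in take D (enum (M y :\: T))].
      apply/subsetP => z; rewrite inE => /mem_take; by rewrite mem_enum.
    rewrite cardsE (card_uniqP _) ?take_uniq ?enum_uniq // size_takel //.
    by rewrite -cardE.
  have dST : [disjoint S & T].
    by move: sS; rewrite subsetD => /andP[].
  have sSM : S \subset M y by apply: subset_trans sS (subsetDl _ _).
  have : packable D X M (y |: Q').
    apply/existsP; exists (S :|: T); apply/and3P; split.
    - by rewrite subUset sTX andbT (subset_trans sSM) ?MX.
    - rewrite cardsU1 yQ' cardsU cS cT; move: dST.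
      by rewrite -setI_eq0 => /eqP ->; rewrite cards0; lia.
    apply/forallP => A; apply/implyP => /forall_inP hA.
    have hy := hA y (setU11 _ _).
    have hQ' : [forall z in Q', #|A :&: M z| <= 1]%N.
      by apply/forall_inP => z zQ'; apply: hA; rewrite setU1r.
    have := TP A; rewrite hQ' /= cardsU1 yQ' setIUr => hT.
    have : (#|A :&: S| <= #|A :&: M y|)%N by rewrite subset_leq_card ?setIS.
    have := leq_of_leqif (leq_card_setU (A :&: S) (A :&: T)).
    by lia.
  move=> packy.
  have := maxQ' (y |: Q'); rewrite packy subUset sub1set yQ sQ' => /(_ isT).
  by rewrite cardsU1 yQ'; lia.
have sQ'' : Q :\: Q' \subset Y by apply: subset_trans (subsetDl _ _) sQY.
have := balM _ _ sQ'' sTX; rewrite cT.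
have -> : (\sum_(y in Q :\: Q') minn (2 * D) #|M y| = #|Q :\: Q'| * (2 * D))%N.
  rewrite -sum_nat_const; apply: eq_bigr => y; rewrite inE => /andP[_ yQ].
  by apply/minn_idPl/Mlarge.
have : (\sum_(y in Q :\: Q') minn (2 * D) #|M y :\: T| <= #|Q :\: Q'| * D)%N.
  rewrite -sum_nat_const; apply: leq_sum => y yQ.
  by apply: leq_trans (geq_minr _ _) (ltnW (small y yQ)).
have : (#|Q| = #|Q'| + #|Q :\: Q'|)%N by rewrite cardsD (setIidPr sQ') subnKC ?subset_leq_card.
move: #|Q :\: Q'| #|Q| #|Q'| => a b c; move: D0; clear.
nia.
Qed.

(** * Selecting pairwise disjoint blocks *)

Lemma leq_card_bigcup (I V : finType) (J : {set I}) (F : I -> {set V})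
    (k : nat) :
  {in J, forall j, #|F j| <= k}%N -> (#|\bigcup_(j in J) F j| <= #|J| * k)%N.
Proof.
move=> leF; rewrite -sum_nat_const.
apply: (@leq_trans (\sum_(j in J) #|F j|)%N); last exact: leq_sum.
elim/big_ind2: _ => [|m1 A1 m2 A2 le1 le2|//]; first by rewrite cards0.
by apply: leq_trans (leq_card_setU _ _) (leq_add _ _).
Qed.

(** For a maximal disjoint subfamily [I], the block of every [x] in [X'] meets some [B i] in a point
    [z]. By symmetry [x] lies in [B z], which leaves at most K^2 choices of [x] for each [i]. *)
Lemma exists_disjoint_subfamily (V : finType) (K : nat) (X X' : {set V})
    (B : V -> {set V}) :
  X' \subset X -> {in X, forall x, B x \subset X} ->
  {in X, forall x, #|B x| <= K}%N -> (forall x, x \in B x) ->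
  (forall x z, z \in B x -> x \in B z) ->
  exists I : {set V}, [/\ I \subset X',
    {in I &, forall i j, i != j -> [disjoint B i & B j]}
    & (#|X'| <= #|I| * K ^ 2)%N].
Proof.
move=> sX'X sBX cB Brefl Bsym.
pose dis (I : {set V}) := [forall i in I, forall j in I, (i != j) ==> [disjoint B i & B j]].
have dis0 : dis set0 by apply/forall_inP => i; rewrite inE.
have [I /andP[sIX /forall_inP disI] maxI] := @arg_maxnP _ set0
  (fun I : {set V} => (I \subset X') && dis I)
  (fun I => #|I|) (introT andP (conj (sub0set X') dis0)).
exists I; split=> //.
  by move=> i j iI jI ij; have /forall_inP/(_ j jI)/implyP := disI i iI; apply.
have sub : X' \subset \bigcup_(i in I) \bigcup_(z in B i) B z.
  apply/subsetP => x xX'.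
  have [xI|xI] := boolP (x \in I).
    by apply/bigcupP; exists x => //; apply/bigcupP; exists x.
  have : ~~ [forall i in I, [disjoint B x & B i]].
    apply/negP => /forall_inP dx.
    have : dis (x |: I).
      apply/forall_inP => i; rewrite in_setU1 => iI; apply/forall_inP => j.
      rewrite in_setU1 => jI; apply/implyP.
      case/orP: iI jI => [/eqP ->|iI] /orP[/eqP ->|jI].
      - by rewrite eqxx.
      - by move=> _; apply: dx.
      - by move=> _; rewrite disjoint_sym dx.
      - by have /forall_inP/(_ j jI)/implyP := disI i iI.
    move=> disx; have := maxI (x |: I).
    by rewrite disx subUset sub1set xX' sIX cardsU1 xI => /(_ isT); lia.
  rewrite negb_forall => /existsP[i]; rewrite negb_imply => /andP[iI].
  rewrite -setI_eq0 => /set0Pn[z]; rewrite inE => /andP[zx zi].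
  by apply/bigcupP; exists i => //; apply/bigcupP; exists z => //; apply: Bsym.
apply: leq_trans (subset_leq_card sub) _.
apply: leq_card_bigcup => i iI.
have iX : i \in X by apply: (subsetP sX'X); apply: (subsetP sIX).
apply: (@leq_trans (#|B i| * K)); last by rewrite expnS expn1 leq_mul2r cB ?orbT.
by apply: leq_card_bigcup => z zi; apply: cB; apply: (subsetP (sBX i iX)).
Qed.

(** * Private neighbours and induced matchings *)

Lemma nbr_sub (V : finType) (e : rel V) (X Y : {set V}) (y : V) :
  bipartition e X Y -> y \in Y -> nbr e y \subset X.
Proof.
case=> XY _ _ indY yY; apply/subsetP => x; rewrite inE => eyx.
have := in_setT x; rewrite -XY inE => /orP[//|xY].
by rewrite (negPf (indY y x yY xY)) in eyx.
Qed.

Lemma irredundant_private (V : finType) (e : rel V) (X Y A : {set V}) (x : V) :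
  simple_graph e -> bipartition e X Y -> A \subset X -> irredundant e A ->
  x \in A -> exists2 y, y \in Y & A :&: nbr e y = [set x].
Proof.
move=> [syme _] [XY _ indX _] sAX /forall_inP irrA xA.
have /subsetPn[y] := irrA x xA; rewrite inE => exy yA.
exists y.
  have := in_setT y; rewrite -XY inE => /orP[yX|//].
  by rewrite (negPf (indX x y (subsetP sAX x xA) yX)) in exy.
apply/setP => z; rewrite !inE; apply/andP/eqP => [[zA eyz]|->]; last first.
  by rewrite xA syme.
apply/eqP; apply: contraNT yA => zx.
by apply/bigcupP; exists z; rewrite !inE ?zx // syme.
Qed.

Lemma irredundant0 (V : finType) (e : rel V) : irredundant e set0.
Proof. by apply/forall_inP => x; rewrite inE. Qed.

(** Each such [x] is paired with some [y] whose only neighbour outside [W] is [x]. All the chosen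
    [x] avoid [W], so no edge joins two different pairs. *)
Lemma card_private_le_im (V : finType) (e : rel V) (X Y W : {set V}) :
  simple_graph e -> bipartition e X Y ->
  (#|[set x in X :\: W | [exists y in Y, nbr e y :\: W == [set x]]]|
   <= im e)%N.
Proof.
move=> [syme irre] bip; set P := [set x in _ | _].
have [XY dXY indX indY] := bip.
(* The default value [x] is never taken when [x] is in [P]. *)
pose m x := odflt x [pick y in Y | nbr e y :\: W == [set x]].
have mP x : x \in P -> m x \in Y /\ nbr e (m x) :\: W = [set x].
  rewrite inE => /andP[_ /existsP[y yP]]; rewrite /m.
  by case: pickP => [z /andP[zY /eqP]|/(_ y)] //; rewrite yP.
have PX x : x \in P -> (x \in X) && (x \notin W).
  by rewrite inE in_setD => /andP[/andP[-> ->]].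
have em x z : x \in P -> z \in P -> e x (m z) = (x == z).
  move=> xP zP; have [_ /setP/(_ x)] := mP z zP.
  rewrite !inE syme; have /andP[_ ->] := PX x xP; done.
clearbody P m; pose S := P :|: m @: P.
have edgeS : induced_edges e S = [set [set x; m x] | x in P].
  apply/setP => E; apply/imset2P/imsetP => [[u v]|[x xP ->]]; last first.
    exists x (m x) => //; first by rewrite inE xP.
    by rewrite !inE em // eqxx andbT; apply/orP; right; apply: imset_f.
  have PP u' v' : u' \in P -> v' \in P -> ~~ e u' v'.
    by move=> /PX/andP[uX _] /PX/andP[vX _]; apply: indX.
  have mm u' v' : u' \in P -> v' \in P -> ~~ e (m u') (m v').
    by move=> /mP[uY _] /mP[vY _]; apply: indY.
  rewrite !inE => /orP[uP|/imsetP[x xP ->]].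
    move=> /andP[/orP[vP|/imsetP[z zP ->]]]; first by rewrite (negPf (PP _ _ uP vP)).
    by rewrite em // => /eqP <- ->; exists u.
  move=> /andP[/orP[vP|/imsetP[z zP ->]]]; last by rewrite (negPf (mm _ _ xP zP)).
  by rewrite syme em // => /eqP -> ->; exists x; rewrite // setUC.
have PmP x z : x \in P -> z \in P -> (x == m z) = false.
  move=> /PX/andP[xX _] /mP[mY _]; apply: contraTF mY => /eqP <-.
  by rewrite (disjointFr dXY).
have minj : {in P &, injective m}.
  move=> x z xP zP emz; apply/eqP; rewrite -em //.
  by rewrite -emz em.
have pairinj : {in P &, injective (fun x => [set x; m x])}.
  move=> x z xP zP /setP/(_ x); rewrite !inE eqxx /= PmP // orbF.
  by move/esym/eqP.
have matchS : induced_matching e S.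
  rewrite /induced_matching edgeS; apply/and3P; split.
  - rewrite /cover; apply/eqP/setP => v; apply/bigcupP/idP.
      move=> [E /imsetP[x xP ->]]; rewrite !inE => /orP[/eqP ->|/eqP ->].
        by rewrite -in_set xP.
      by apply/orP; right; apply: imset_f.
    rewrite inE => /orP[vP|/imsetP[x xP ->]].
      by exists [set v; m v]; rewrite ?inE ?eqxx //; apply: imset_f.
    by exists [set x; m x]; rewrite ?inE ?eqxx ?orbT //; apply: imset_f.
  - apply/trivIsetP => E F /imsetP[x xP ->] /imsetP[z zP ->] nEF.
    have xz : x != z by apply: contraNneq nEF => ->.
    rewrite -setI_eq0; apply/eqP/setP => v; rewrite !inE.
    apply/negbTE/negP => /andP[/orP[]/eqP -> /orP[]].
    + by rewrite (negPf xz).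
    + by rewrite PmP.
    + by rewrite eq_sym PmP.
    + by move=> /eqP/minj => /(_ xP zP)/eqP; rewrite (negPf xz).
  - by apply/imsetP => -[x _ /setP/(_ x)]; rewrite !inE eqxx.
rewrite -(card_in_imset pairinj) -edgeS /im.
exact: (leq_bigmax_cond (F := fun S => #|induced_edges e S|)).
Qed.

(** * Blocked vertices *)

Definition low_nbrs (V : finType) (D : nat) (Y : {set V}) (M : V -> {set V})
    (x : V) : {set V} := [set y in Y | (x \in M y) && (#|M y| <= D)%N].

(** The coordinates that decide whether [x] is blocked. Vertices with disjoint blocks are blocked
    independently. *)
Definition low_block (V : finType) (D : nat) (Y : {set V}) (M : V -> {set V})
    (x : V) : {set V} := x |: \bigcup_(y in low_nbrs D Y M x) M y.

Definition blocked (V : finType) (D : nat) (Y : {set V}) (M : V -> {set V})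
    (x : V) (A : {set V}) : bool :=
  (x \in A) && [forall y in low_nbrs D Y M x, A :&: (M y :\ x) != set0].

Lemma depends_on_blocked (V : finType) (D : nat) (Y : {set V})
    (M : V -> {set V}) (x : V) :
  depends_on (low_block D Y M x) (blocked D Y M x).
Proof.
move=> A1 A2 eA; congr (_ && _).
  by have /setP/(_ x) := eA; rewrite !inE eqxx !andbT.
apply: eq_forallb_in => y yZ; congr (_ != _).
have sM : M y :\ x \subset low_block D Y M x.
  apply: subset_trans (subsetDl _ _) (subset_trans _ (subsetUr _ _)).
  exact: bigcup_sup.
by rewrite -(setIidPr sM) !setIA eA.
Qed.

Lemma low_block_sym (V : finType) (D : nat) (Y : {set V}) (M : V -> {set V})
    (x z : V) : z \in low_block D Y M x -> x \in low_block D Y M z.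
Proof.
case/setU1P=> [->|/bigcupP[y]]; first exact: setU11.
rewrite inE => /and3P[yY xy cy] zy; apply/setU1P; right.
by apply/bigcupP; exists y; rewrite // inE yY zy.
Qed.

(** On [0, 1/2] one has 1 / (1 - t) <= 1 + 2t <= e^(2t). *)
Lemma expR_le1B (R : realType) (t : R) :
  0 <= t -> t <= 2^-1 -> expR (- (2 * t)) <= 1 - t.
Proof.
move=> t0 t1; rewrite expRN -[leRHS]invrK lef_pV2 ?posrE ?expR_gt0 ?invr_gt0; try lra.
apply: le_trans (expR_ge1Dx _); rewrite -div1r ler_pdivrMr; nra.
Qed.

(* Both [x \in A] and the events that [A] meets [M y :\ x] are increasing in
   [A], so Harris' inequality bounds the probability of their conjunction from
   below by the product. *)
Lemma avg_blocked_ge (R : realType) (V : finType) (D : nat) (X Y : {set V})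
    (M : V -> {set V}) (x : V) :
  x \in X -> {in Y, forall y, M y \subset X} ->
  {in Y, forall y, x \in M y -> (1 < #|M y|)%N} ->
  expR (- (2 * \sum_(y in low_nbrs D Y M x) (2^-1) ^+ #|M y|.-1)) / 2
  <= avg (enum X) (fun A => (blocked D Y M x A)%:R) set0 :> R.
Proof.
move=> xX MX M2; set Z := low_nbrs D Y M x.
pose g (y : V) (A : {set V}) : R := (A :&: (M y :\ x) != set0)%:R.
have incg y : increasing (g y).
  move=> A A' sA; rewrite /g ler_nat; case: (altP (A :&: _ =P set0)) => //= nz.
  suff -> : A' :&: (M y :\ x) != set0 by [].
  by apply: contraNneq nz => z; rewrite -subset0 -z setSI.
have g0 y A : 0 <= g y A by rewrite ler0n.
pose h (A : {set V}) : R := if x \in A then 1 else 0.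
have inch : increasing h.
  move=> A A' sA; rewrite /h; case: ifP => [/(subsetP sA) -> //|_].
  by case: ifP.
have incp : increasing (fun A => \prod_(y in Z) g y A).
  by move=> B B' sB; apply: ler_prod => j Pj; rewrite g0 incg.
apply: (@le_trans _ _ (avg (enum X) (fun A => h A * \prod_(y in Z) g y A) set0)).
  apply: le_trans (harris _ _ inch incp).
  rewrite avg_coord ?mem_enum ?inE ?enum_uniq // mulrC addr0 div1r.
  rewrite ler_wpM2l ?invr_ge0 //.
  apply: le_trans (harris_prod _ _ _ (fun y _ => incg y) g0).
  rewrite mulr_sumr -sumrN expR_sum; apply: ler_prod => y; rewrite inE => /and3P[yY xy _].
  rewrite expR_ge0 /= avg_meets; last first.
    by apply: subset_trans (subsetDl _ _) (MX y yY).
  have := M2 y yY xy; rewrite (cardsD1 x (M y)) xy add1n ltnS /= => c0.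
  apply: expR_le1B; first by rewrite exprn_ge0 ?invr_ge0.
  case: #|_| c0 => // k _; rewrite exprS ler_piMr ?invr_ge0 //.
  by rewrite exprn_ile1 ?invr_ge0 //; lra.
apply: ler_avg => A; rewrite /blocked /h; case: (x \in A); last by rewrite mul0r.
rewrite mul1r /=; case: (altP forall_inP) => [_|].
  by apply: prodr_ile1 => y _; rewrite g0 /g lern1 leq_b1.
rewrite negb_forall => /existsP[y]; rewrite negb_imply negbK => /andP[yZ /eqP e0].
by rewrite (bigD1 y) //= {1}/g e0 eqxx mul0r.
Qed.

(** * Heavy vertices and exponential moments *)

Lemma expR1_le4 (R : realType) : expR 1 <= 4 :> R.
Proof.
have := expR_ge1Dx (- 2^-1 : R); rewrite expRN => h.
have e0 := expR_gt0 (2^-1 : R).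
have -> : (1 : R) = 2^-1 + 2^-1 by lra.
rewrite expRD; have : expR 2^-1 <= 2 :> R.
  by rewrite -[leLHS]invrK invf_ple ?posrE ?invr_gt0 //; lra.
nra.
Qed.

(** Double counting: a single [y] contributes at most |M y| 2^(1 - |M y|) <= 1 to the sum of all
    weights. *)
Lemma card_heavy_le (R : realFieldType) (V : finType) (D c : nat)
    (X Y : {set V}) (M : V -> {set V}) :
  c%:R * #|[set x in X |
     c%:R < \sum_(y in low_nbrs D Y M x) (2^-1) ^+ #|M y|.-1 :> R]|%:R
  <= #|Y|%:R :> R.
Proof.
set H := [set x in X | _].
pose w (y : V) : R := (2^-1) ^+ #|M y|.-1.
have w0 y : 0 <= w y by rewrite exprn_ge0 ?invr_ge0.
apply: (@le_trans _ _ (\sum_(x in H) \sum_(y in low_nbrs D Y M x) w y)).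
  rewrite mulr_natr -sumr_const; apply: ler_sum => x; rewrite inE => /andP[_].
  exact: ltW.
rewrite (exchange_big_dep (mem Y)) /=; last by move=> x y _; rewrite inE => /andP[].
rewrite -sum1_card natr_sum; apply: ler_sum => y yY.
rewrite sumr_const.
apply: (@le_trans _ _ (w y *+ #|M y|)).
  rewrite ler_wpMn2l // subset_leq_card //.
  by apply/subsetP => x /andP[_]; rewrite inE => /and3P[].
rewrite /w; case: #|M y| => [|k] /=; first by rewrite mulr0n.
rewrite exprVn -[leLHS]mulr_natl ler_pdivrMr ?exprn_gt0 // mul1r -natrX ler_nat.
exact: ltn_expl.
Qed.

Lemma expRN_nat_bool_le (R : realType) (b : bool) :
  expR (- b%:R) <= 1 - b%:R / 2 :> R.
Proof.
case: b => /=; last by rewrite oppr0 expR0 mul0r subr0.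
have -> : 1 - 1 / 2 = 2^-1 :> R by lra.
rewrite expRN lef_pV2 ?posrE ?expR_gt0 //.
by apply: le_trans (expR_ge1Dx _).
Qed.

(** On the event, |A :&: T| <= |Q|, so its indicator is at most 2^(|Q| - |A :&: T|). The mean of
    2^(-|A :&: T|) is (3/4)^|T|, with |T| = D |Q|. *)
Lemma avg_packable_le (R : realFieldType) (V : finType) (D : nat)
    (X Q : {set V}) (M : V -> {set V}) :
  packable D X M Q ->
  avg (enum X) (fun A => [forall y in Q, #|A :&: M y| <= 1]%N%:R) set0
  <= (2 * (3 / 4) ^+ D) ^+ #|Q| :> R.
Proof.
case/existsP=> T /and3P[sTX /eqP cT /forallP TP].
have -> : (2 * (3 / 4) ^+ D) ^+ #|Q|
    = 2 ^+ #|Q| * avg (enum X) (fun A => 2^-1 ^+ #|A :&: T|) set0 :> R.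
  rewrite avg_expr_card // cT exprMn exprM; congr (_ * (_ ^+ _ ^+ _)).
  by field.
rewrite -avgZ; apply: ler_avg => A.
have := TP A; case: [forall y in Q, _] => [/= leT|_ /=]; last first.
  by rewrite mulr_ge0 ?exprn_ge0 ?invr_ge0.
rewrite exprVn ler_pdivlMr ?exprn_gt0 // mul1r.
by rewrite ler_weXn2l // ler1n.
Qed.

(* If [A] satisfies the condition, then the blocked elements of [I] have distinct
   private neighbours [y], all with [2 * D < #|M y|] and [#|A :&: M y| <= 1].
   The first term bounds the probability of at most [kappa] blocked elements,
   the second one that of more than [kappa] such [y]. *)
Lemma avg_private_le (R : realType) (V : finType) (L D : nat)
    (X Y I : {set V}) (M : V -> {set V}) (p kappa : R) :
  balanced L (2 * D) X Y M -> (0 < D)%N -> {in Y, forall y, M y \subset X} ->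
  {in I &, forall i j, i != j ->
     [disjoint low_block (2 * D) Y M i & low_block (2 * D) Y M j]} ->
  {in I, forall x,
     p <= avg (enum X) (fun A => (blocked (2 * D) Y M x A)%:R) set0} ->
  avg (enum X) (fun A => [forall x in A :&: I,
      [exists y in Y, A :&: M y == [set x]]]%:R) set0
  <= expR (kappa - p * #|I|%:R / 2)
     + expR (#|Y|%:R * (expR 1 * (2 * (3 / 4) ^+ D)) - kappa / L.+1%:R).
Proof.
move=> balM D0 MX disI leP.
pose bl := blocked (2 * D) Y M.
pose few (Q A : {set V}) := [forall y in Q, #|A :&: M y| <= 1]%N.
pose fI (A : {set V}) := \prod_(x in I) expR (- (bl x A)%:R) : R.
pose Z (A : {set V}) := \sum_(Q : {set V} | (Q \subset Y) && packable D X M Q)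
  expR 1 ^+ #|Q| * (few Q A)%:R : R.
(* A pointwise bound on the indicator: with at most [kappa] blocked elements the first term is at
   least 1. Otherwise a packable [Q] of size above kappa / (L + 1) makes the second term at least
   1. *)
apply: (@le_trans _ _ (avg (enum X)
   (fun A => expR kappa * fI A + expR (- (kappa / L.+1%:R)) * Z A) set0)).
  apply: ler_avg => A.
  have fI0 : 0 <= fI A by apply: prodr_ge0 => x _; apply: expR_ge0.
  have Z0 : 0 <= Z A.
    by apply: sumr_ge0 => Q _; rewrite mulr_ge0 ?exprn_ge0 ?expR_ge0.
  case: (altP forall_inP) => [priv|_]; last first.
    by rewrite addr_ge0 ?mulr_ge0 ?expR_ge0.
  pose J := [set x in I | bl x A].
  have fIE : fI A = expR (- #|J|%:R).
    rewrite /fI -expR_sum; congr expR; rewrite sumrN -natr_sum; congr (- _%:R).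
    rewrite -sum1_card [RHS](eq_bigl (fun x => (x \in I) && bl x A)) => [|x].
      by rewrite [RHS]big_mkcondr; apply: eq_bigr => x _; case: (bl x A).
    by rewrite inE.
  have [leJ|ltJ] := lerP (#|J|%:R) kappa.
    rewrite -[leLHS]addr0 lerD ?mulr_ge0 ?expR_ge0 //.
    by rewrite fIE -expRD -[leLHS]expR0 ler_expR subr_ge0.
  rewrite -[leLHS]add0r lerD ?mulr_ge0 ?expR_ge0 //.
  pose H := [set y in Y | (2 * D < #|M y|)%N && (#|A :&: M y| <= 1)%N].
  have sHY : H \subset Y by apply/subsetP => y; rewrite inE => /andP[].
  have leJH : (#|J| <= #|H|)%N.
    rewrite -[leqRHS]muln1.
    apply: leq_trans (@leq_card_bigcup _ _ H (fun y => A :&: M y) 1 _); last first.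
      by move=> y; rewrite inE => /and3P[].
    apply: subset_leq_card; apply/subsetP => x; rewrite inE => /andP[xI].
    case/andP=> xA /forall_inP hit.
    have /existsP[y /andP[yY /eqP Ay]] := priv x (introT setIP (conj xA xI)).
    have xAy : x \in A :&: M y by rewrite Ay inE.
    apply/bigcupP; exists y => //; rewrite inE yY Ay cards1 leqnn andbT /=.
    rewrite ltnNge; apply/negP => cy.
    have /hit : y \in low_nbrs (2 * D) Y M x.
      by rewrite inE yY cy andbT; move: xAy; rewrite inE => /andP[].
    by rewrite setIDA Ay setDv eqxx.
  have [||Q sQH /andP[pQ cQ]] := exists_packable balM D0 sHY.
  - by move=> y; rewrite inE => /andP[yY _]; apply: MX.
  - by move=> y; rewrite inE => /and3P[_ /ltnW].
  have fewQ : few Q A.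
    by apply/forall_inP => y /(subsetP sQH); rewrite inE => /and3P[].
  have sQY : Q \subset Y by apply: subset_trans sQH sHY.
  apply: (@le_trans _ _ (expR (- (kappa / L.+1%:R)) * expR 1 ^+ #|Q|)).
    rewrite -expRM_natl mulr1 -expRD -[leLHS]expR0 ler_expR addrC subr_ge0.
    rewrite ler_pdivrMr ?ltr0n // mulrC -natrM.
    by rewrite (le_trans (ltW ltJ)) // ler_nat (leq_trans leJH).
  rewrite ler_wpM2l ?expR_ge0 // /Z (bigD1 Q) ?sQY //= fewQ mulr1 lerDl.
  by apply: sumr_ge0 => Q' _; rewrite mulr_ge0 ?exprn_ge0 ?expR_ge0.
rewrite avgD !avgZ; apply: lerD.
  rewrite (@avg_prod_disjoint _ _ _ _ _ (low_block (2 * D) Y M)) //; last first.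
    by move=> x A A' eA; rewrite /bl (depends_on_blocked eA).
  rewrite expRD ler_wpM2l ?expR_ge0 //.
  (* For b in {0, 1}, e^(-b) <= 1 - b/2, so each independent factor averages to at most 1 - p/2 <=
     e^(-p/2). *)
  have -> : - (p * #|I|%:R / 2) = \sum_(x in I) - (p / 2).
    by rewrite sumr_const -mulr_natr; field.
  rewrite expR_sum; apply: ler_prod => x xI; apply/andP; split.
    by rewrite -[leLHS](avg_cst (enum X) 0 set0); apply: ler_avg => A; apply: expR_ge0.
  apply: (@le_trans _ _ (avg (enum X) (fun A => 1 + - 2^-1 * (bl x A)%:R) set0)).
    apply: ler_avg => A; apply: le_trans (expRN_nat_bool_le _ _) _; lra.
  rewrite avgD avgZ avg_cst; apply: le_trans (expR_ge1Dx _).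
  by have := leP x xI; rewrite -/bl; lra.
rewrite [leRHS]expRD mulrC ler_wpM2r ?expR_ge0 //.
rewrite avg_sum; set q := 2 * _; set c := expR 1 * q.
have q0 : 0 <= q by rewrite mulr_ge0 ?exprn_ge0 //; lra.
have c0 : 0 <= c by rewrite mulr_ge0 ?expR_ge0.
(* The bound on each term no longer mentions packability; summing it over all subsets of [Y] gives
   (1 + c)^|Y| <= e^(c |Y|). *)
apply: (@le_trans _ _ (\sum_(Q : {set V} | Q \subset Y) c ^+ #|Q|)).
  rewrite big_mkcondr; apply: ler_sum => Q _.
  case: ifP => [pQ|_]; last by rewrite exprn_ge0.
  rewrite avgZ exprMn ler_wpM2l ?exprn_ge0 ?expR_ge0 //.
  exact: avg_packable_le.
rewrite sum_expr_subset expRM_natl.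
by rewrite lerXn2r ?nnegrE ?expR_ge0 ?addr_ge0 ?expR_ge1Dx.
Qed.

(** * Light vertices: their blocking probability and their number *)

(** Weight at most 8N gives probability at least e^(-16N) / 2, and e <= 4 bounds this below by
    2^(-32N - 1) >= 2^(-33N). *)
Lemma avg_light_blocked_ge (R : realType) (V : finType) (D N : nat)
    (X Y : {set V}) (M : V -> {set V}) (x : V) :
  (0 < N)%N -> x \in X -> {in Y, forall y, M y \subset X} ->
  {in Y, forall y, M y != [set x]} ->
  \sum_(y in low_nbrs D Y M x) (2^-1) ^+ #|M y|.-1 <= (8 * N)%:R :> R ->
  2^-1 ^+ (33 * N)
  <= avg (enum X) (fun A => (blocked D Y M x A)%:R) set0 :> R.
Proof.
move=> N0 xX MX Mx wx.
have M2 : {in Y, forall y, x \in M y -> (1 < #|M y|)%N}.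
  move=> y yY xy; rewrite ltn_neqAle card_gt0 andbC; apply/andP; split.
    by apply/set0Pn; exists x.
  rewrite eq_sym; apply: contra (Mx y yY) => /cards1P[z Mz].
  by move: xy; rewrite Mz inE => /eqP ->.
apply: le_trans (avg_blocked_ge R D xX MX M2).
apply: (@le_trans _ _ (expR (- (16 * N)%:R) / 2)); last first.
  by rewrite ler_pM2r ?invr_gt0 // ler_expR lerN2 natrM; rewrite natrM in wx; lra.
have e4 : 4^-1 <= (expR 1)^-1 :> R by rewrite lef_pV2 ?posrE ?expR_gt0 ?expR1_le4.
apply: (@le_trans _ _ (4^-1 ^+ (16 * N) / 2)); last first.
  rewrite ler_pM2r ?invr_gt0 // expRN -[(16 * N)%:R]mulr1 expRM_natl -exprVn.
  by apply: lerXn2r; rewrite ?nnegrE ?invr_ge0 ?expR_ge0.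
have -> : 4^-1 = 2^-1 ^+ 2 :> R by rewrite expr2; field.
rewrite -exprM -exprSr ler_wiXn2l ?invr_ge0 //; [lra | lia].
Qed.

Definition light (R : realFieldType) (V : finType) (D N : nat)
    (X Y : {set V}) (M : V -> {set V}) : {set V} :=
  [set x in X | [forall y in Y, M y != [set x]]
    && (\sum_(y in low_nbrs D Y M x) (2^-1) ^+ #|M y|.-1 <= (8 * N)%:R :> R)].

(** [X] is covered by the light vertices, those with a singleton [M y] (at most [im e] < n - n/N),
    the heavy ones (at most 2n/(8N)) and [W] (at most n/(4N)). More than n/(2N) are left for the
    light ones. *)
Lemma card_light (R : realFieldType) (V : finType) (e : rel V) (D N n : nat)
    (X Y W : {set V}) :
  simple_graph e -> bipartition e X Y -> #|X| = n -> #|Y| = (2 * n)%N ->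
  (N * im e + n < N * n)%N -> W \subset X -> (4 * N * #|W| <= n)%N ->
  (n < 2 * N * #|light R D N (X :\: W) Y (fun y => nbr e y :\: W)|)%N.
Proof.
move=> smp bip cX cY ltim sWX cW; set M := fun y => _.
set G := light _ _ _ _ _ _.
have := card_private_le_im W smp bip; set P := [set x in _ | _] => cP.
have := card_heavy_le R D (8 * N) (X :\: W) Y M.
rewrite -natrM ler_nat cY; set H := [set x in _ | _] => cH.
have sXU : X \subset G :|: P :|: H :|: W.
  apply/subsetP => x xX; have [xW|xW] := boolP (x \in W).
    by rewrite inE xW orbT.
  have xXW : x \in X :\: W by rewrite inE xW.
  have [xH|xH] := boolP (x \in H); first by rewrite !in_setU xH orbT.
  have [xP|xP] := boolP (x \in P); first by rewrite !in_setU xP orbT.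
  suff xG : x \in G by rewrite !in_setU xG.
  move: xH xP; rewrite !inE -!in_setD xXW /= -leNgt => -> nP; rewrite andbT.
  apply/forall_inP => y yY; apply: contra nP => /eqP My.
  by apply/existsP; exists y; rewrite yY /= -/(M y) My.
have := subset_leq_card sXU; rewrite cX.
have := leq_of_leqif (leq_card_setU (G :|: P :|: H) W).
have := leq_of_leqif (leq_card_setU (G :|: P) H).
have := leq_of_leqif (leq_card_setU G P).
move: cP cH cW ltim.
move: #|G :|: P :|: H :|: W| #|G :|: P :|: H| #|G :|: P| => u v w.
move: #|G| #|P| #|H| #|W| (im e) => g p h k i; clear.
move=> pi hn kn ltn uw vw wv nu.
have : (n <= g + p + h + k)%N by lia.
nia.
Qed.

(** * The probability that a random set is irredundant *)

Definition irredundant_sub (V : finType) (e : rel V) (X A : {set V}) : bool :=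
  (A \subset X) && irredundant e A.

Lemma irrE (R : realFieldType) (V : finType) (e : rel V) (X : {set V}) :
  (irr e X)%:R
  = 2 ^+ #|X| * avg (enum X) (fun A => (irredundant_sub e X A)%:R) set0 :> R.
Proof.
rewrite cardE -sum_subset_avg ?enum_uniq // /irr -sum1_card natr_sum.
have -> : [set x in enum X] = X by apply/setP=> x; rewrite inE mem_enum.
rewrite [RHS](eq_bigr (fun A => if irredundant_sub e X A then 1 else 0)).
  rewrite -big_mkcondr; apply: eq_bigl => A.
  by rewrite inE /irredundant_sub andbA andbb.
by move=> A _; rewrite set0U; case: ifP.
Qed.

Lemma avg_irredundant_le1B (R : realType) (V : finType) (e : rel V)
    (N n : nat) (X Y : {set V}) :
  (0 < N)%N ->
  simple_graph e -> bipartition e X Y -> #|X| = n -> #|Y| = (2 * n)%N ->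
  (N * im e + n < N * n)%N ->
  avg (enum X) (fun A => (irredundant_sub e X A)%:R) set0
  <= 1 - 2^-1 ^+ (33 * N) :> R.
Proof.
move=> N0 smp bip cX cY ltim.
(* With threshold |V| every [y] is low, so one blocked [x] already excludes irredundance. *)
have := @card_light R V e #|V| N n X Y set0 smp bip cX cY ltim (sub0set X).
rewrite cards0 muln0 setD0 => /(_ isT); set M := fun y => _; set G := light _ _ _ _ _ _.
move=> ltG; have /card_gt0P[x] : (0 < #|G|)%N by lia.
rewrite inE => /and3P[xX /forall_inP Mx wx].
have MX : {in Y, forall y, M y \subset X}.
  by move=> y yY; rewrite /M setD0 (nbr_sub bip).
have := avg_light_blocked_ge N0 xX MX Mx wx; set b := avg _ _ _ => leb.
apply: (@le_trans _ _ (1 + -1 * b)); last by lra.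
rewrite /b -avgZ -[X in X + _](avg_cst (enum X) (1 : R) set0) -avgD.
apply: ler_avg => A; have [bA|_] := boolP (blocked _ _ _ _ _); last first.
  by rewrite mulr0 addr0 lern1 leq_b1.
suff /negPf -> : ~~ irredundant_sub e X A by rewrite mulN1r subrr.
apply/negP => /andP[sAX irrA]; move: bA => /andP[xA /forall_inP hit].
have [y yY Ay] := irredundant_private smp bip sAX irrA xA.
have /hit : y \in low_nbrs #|V| Y M x.
  rewrite inE yY max_card andbT /M setD0.
  by have /setP/(_ x) := Ay; rewrite !inE eqxx xA.
by rewrite /M setD0 setIDA Ay setDv eqxx.
Qed.

Lemma low_block_sub (V : finType) (D : nat) (X Y : {set V})
    (M : V -> {set V}) (x : V) :
  {in Y, forall y, M y \subset X} -> x \in X -> low_block D Y M x \subset X.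
Proof.
move=> MX xX; rewrite subUset sub1set xX; apply/bigcupsP => y.
by rewrite inE => /and3P[yY _ _]; apply: MX.
Qed.

Lemma card_low_block (V : finType) (L D : nat) (X Y : {set V})
    (M : V -> {set V}) (x : V) :
  balanced L D X Y M -> x \in X -> (#|low_block D Y M x| <= (L * D).+1)%N.
Proof.
move=> balM xX; rewrite cardsU1 -add1n leq_add ?leq_b1 //.
apply: leq_trans (_ : _ <= #|low_nbrs D Y M x| * D)%N _.
  by apply: leq_card_bigcup => y; rewrite inE => /and3P[].
by rewrite leq_mul2r (balanced_low_degree balM xX) orbT.
Qed.

(** The value of [L] turns L |W| <= 2D |Y| = 4Dn into |W| <= n/(4N), as [card_light] requires. [m]
    counts light vertices with pairwise disjoint blocks. *)
Lemma avg_irredundant_le_tail (R : realType) (V : finType) (e : rel V)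
    (N n : nat) (X Y : {set V}) :
  let D := (2 ^ 9 * N)%N in let L := (16 * D * N)%N in
  let p : R := 2^-1 ^+ (33 * N) in
  (0 < N)%N ->
  simple_graph e -> bipartition e X Y -> #|X| = n -> #|Y| = (2 * n)%N ->
  (N * im e + n < N * n)%N ->
  exists2 m : nat, (n <= 2 * N * (m * (L * (2 * D)).+1 ^ 2))%N &
  avg (enum X) (fun A => (irredundant_sub e X A)%:R) set0
  <= expR (- (p * m%:R / 4))
     + expR ((2 * n)%:R * (expR 1 * (2 * (3 / 4) ^+ D))
             - p * m%:R / 4 / L.+1%:R) :> R.
Proof.
move=> D L p N0 smp bip cX cY ltim.
have D0 : (0 < D)%N by rewrite muln_gt0 expn_gt0.
have [W [sWX cW balM]] := exists_balanced L (2 * D) X Y (nbr e).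
set M := fun y => _ in balM.
have cW' : (4 * N * #|W| <= n)%N.
  rewrite -(@leq_pmul2l (4 * D)) ?muln_gt0 ?D0 //.
  by move: cW; rewrite cY /L; lia.
have ltG := card_light R (2 * D) smp bip cX cY ltim sWX cW'.
set G := light _ _ _ _ _ _ in ltG.
have sGX : G \subset X by apply/subsetP => x; rewrite !inE => /andP[/andP[]].
have MX : {in Y, forall y, M y \subset X}.
  by move=> y yY; apply: subset_trans (subsetDl _ _) (nbr_sub bip yY).
have [||||I [sIG disI cG]] := @exists_disjoint_subfamily V (L * (2 * D)).+1 X G
   (low_block (2 * D) Y M) sGX.
- by move=> x; apply: low_block_sub.
- by move=> x; apply: card_low_block.
- by move=> x; apply: setU11.
- by move=> x z; apply: low_block_sym.
exists #|I|.
  by apply: leq_trans (ltnW ltG) _; rewrite leq_mul2l cG orbT.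
have lep : {in I, forall x,
    p <= avg (enum X) (fun A => (blocked (2 * D) Y M x A)%:R) set0}.
  move=> x /(subsetP sIG) xG; have xX := subsetP sGX x xG.
  move: xG; rewrite inE => /and3P[_ /forall_inP Mx wx].
  exact: avg_light_blocked_ge wx.
(* This [kappa] is half of the available p |I| / 2, which leaves decay in both terms. *)
have := avg_private_le (p * #|I|%:R / 4) balM D0 MX disI lep; rewrite cY.
have -> : p * #|I|%:R / 4 - p * #|I|%:R / 2 = - (p * #|I|%:R / 4) by lra.
apply: le_trans; apply: ler_avg => A; rewrite ler_nat.
have [/andP[sAX irrA]|//] := boolP (irredundant_sub e X A).
suff -> : [forall x in A :&: I, [exists y in Y, A :&: M y == [set x]]] by [].
apply/forall_inP => x; rewrite inE => /andP[xA xI].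
have [y yY Ay] := irredundant_private smp bip sAX irrA xA.
apply/existsP; exists y; rewrite yY /M setIDA Ay.
have : x \notin W by move: (subsetP sIG x xI); rewrite !inE => /andP[/andP[]].
by move=> xW; apply/eqP/setDidPl; rewrite disjoints1.
Qed.

(** * Constants and conclusion *)

(** Bounds the total loss from [n] to [m] and from [kappa] to kappa / (L + 1). The product is at
    most 2^66 N^9, and N <= 2^N. *)
Lemma size_bound (N : nat) :
  let D := (2 ^ 9 * N)%N in let L := (16 * D * N)%N in
  (0 < N)%N ->
  (16 * N * (L * (2 * D)).+1 ^ 2 * L.+1 <= 2 ^ (75 * N))%N.
Proof.
move=> D L N0; have lN : (N <= 2 ^ N)%N by apply/ltnW/ltn_expl.
have eL : L = (2 ^ 13 * N ^ 2)%N.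
  rewrite /L /D (_ : 2 ^ 13 = 16 * 2 ^ 9)%N; last by rewrite -(expnD 2 4 9).
  by move: (2 ^ 9)%N => a; ring.
have eK : (L * (2 * D) = 2 ^ 23 * N ^ 3)%N.
  rewrite eL /D (_ : 2 ^ 23 = 2 ^ 13 * 2 ^ 9 * 2)%N; last by rewrite -expnD -expnSr.
  by move: (2 ^ 13)%N (2 ^ 9)%N => a b; ring.
have bound k j : ((2 ^ k * N ^ j).+1 <= 2 ^ k.+1 * N ^ j)%N.
  have : (0 < 2 ^ k * N ^ j)%N by rewrite muln_gt0 !expn_gt0 N0.
  by rewrite expnS -mulnA; lia.
rewrite eK eL.
apply: (@leq_trans (2 ^ 4 * N * (2 ^ 24 * N ^ 3) ^ 2 * (2 ^ 14 * N ^ 2)))%N.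
  by apply: leq_mul; rewrite ?bound // leq_mul // leq_exp2r.
have -> : (2 ^ 4 * N * (2 ^ 24 * N ^ 3) ^ 2 * (2 ^ 14 * N ^ 2)
           = 2 ^ 66 * N ^ 9)%N.
  rewrite expnMn -!expnM (_ : 2 ^ 66 = 2 ^ 4 * 2 ^ 48 * 2 ^ 14)%N; last by rewrite -!expnD.
  rewrite (_ : N ^ 9 = N * N ^ 6 * N ^ 2)%N; last by rewrite -expnS -expnD.
  by move: (2 ^ 4)%N (2 ^ 48)%N (2 ^ 14)%N (N ^ 6)%N (N ^ 2)%N => a b c d f; ring.
apply: (@leq_trans (2 ^ (66 * N) * 2 ^ (9 * N)))%N.
  apply: leq_mul; first by rewrite leq_exp2l // leq_pmulr.
  by rewrite mulnC expnM leq_exp2r.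
by rewrite -expnD leq_exp2l // -mulnDl.
Qed.

(** (3/4)^5 = 243/1024 < 1/4, and 2^9 >= 5 * 100. *)
Lemma ratio_decay (R : realFieldType) (N : nat) :
  (3 / 4) ^+ (2 ^ 9 * N) <= 2^-1 ^+ (200 * N) :> R.
Proof.
have h : (3 / 4) ^+ 5 <= 2^-1 ^+ 2 :> R by lra.
apply: (@le_trans _ _ ((3 / 4) ^+ (5 * (100 * N)))).
  by rewrite ler_wiXn2l //; [lra | lra | rewrite mulnA leq_mul2r orbT].
rewrite exprM (_ : 200 * N = 2 * (100 * N))%N; last by lia.
rewrite [leRHS]exprM lerXn2r // nnegrE exprn_ge0 //; lra.
Qed.

(** The exponent 108 = 33 + 75 combines the blocking probability with the loss in [size_bound]. *)
Lemma avg_irredundant_le_large (R : realType) (V : finType) (e : rel V)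
    (N n : nat) (X Y : {set V}) :
  (0 < N)%N ->
  simple_graph e -> bipartition e X Y -> #|X| = n -> #|Y| = (2 * n)%N ->
  (N * im e + n < N * n)%N ->
  avg (enum X) (fun A => (irredundant_sub e X A)%:R) set0
  <= 2 * expR (- (2^-1 ^+ (108 * N) * n%:R)) :> R.
Proof.
move=> N0 smp bip cX cY ltim.
have [m lenm] := avg_irredundant_le_tail R N0 smp bip cX cY ltim.
set L := (16 * _ * N)%N; set D := (2 ^ 9 * N)%N; set p : R := 2^-1 ^+ (33 * N).
set K := (L * (2 * D)).+1 in lenm *.
move/le_trans; apply.
have p0 : 0 < p by rewrite exprn_gt0 ?invr_gt0.
set eta : R := 2^-1 ^+ (108 * N).
have eta0 : 0 < eta by rewrite exprn_gt0 ?invr_gt0.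
set th : R := 2^-1 ^+ (75 * N).
have th0 : 0 < th by rewrite exprn_gt0 ?invr_gt0.
have etaE : eta = p * th by rewrite /eta /p /th -exprD; congr (_ ^+ _); lia.
have L0 : 0 < L.+1%:R :> R by rewrite ltr0n.
have sz : th * (16 * N%:R * K%:R ^+ 2 * L.+1%:R) <= 1.
  have : (16 * N * K ^ 2 * L.+1 <= 2 ^ (75 * N))%N by apply: size_bound.
  rewrite -(ler_nat R) 3!natrM !natrX => le2.
  by rewrite /th exprVn [leLHS]mulrC ler_pdivrMr ?exprn_gt0 // mul1r.
(* The factor 2 leaves one [eta * n%:R] to absorb the packing term, bounded in [qs]. *)
have kap : 2 * (eta * n%:R) <= p * m%:R / 4 / L.+1%:R.
  rewrite ler_pdivlMr // etaE.
  have nm : n%:R <= 2 * N%:R * (m%:R * K%:R ^+ 2) :> R.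
    by rewrite -natrX -!natrM ler_nat.
  have : 2 * (p * th * n%:R) * L.+1%:R
         <= 2 * (p * th * (2 * N%:R * (m%:R * K%:R ^+ 2))) * L.+1%:R.
    by rewrite ler_pM2r // ler_pM2l // ler_pM2l // mulr_gt0.
  move/le_trans; apply.
  have : p * m%:R / 4 * (th * (16 * N%:R * K%:R ^+ 2 * L.+1%:R)) <= p * m%:R / 4 * 1.
    by rewrite ler_wpM2l // divr_ge0 // mulr_ge0 // ltW.
  by move: (K%:R ^+ 2) (N%:R : R) (L.+1%:R : R) => a b c; lra.
have low : eta * n%:R <= p * m%:R / 4.
  have en0 : 0 <= eta * n%:R by rewrite mulr_ge0 // ltW.
  have : p * m%:R / 4 / L.+1%:R <= p * m%:R / 4.
    by rewrite ler_pdivrMr // ler_peMr ?ler1n // divr_ge0 // mulr_ge0 // ltW.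
  move: kap; set z := _ / _ / _; lra.
have qs : 2 * (expR 1 * (2 * (3 / 4) ^+ D)) <= eta.
  have := ratio_decay R N; rewrite -/D => dec.
  have e4 := expR1_le4 R; have e0 := expR_gt0 (1 : R).
  have D0 : 0 <= (3 / 4) ^+ D :> R by rewrite exprn_ge0 //; lra.
  have : 2^-1 ^+ (200 * N) <= 2^-1 ^+ 4 * eta.
    rewrite /eta -exprD ler_wiXn2l ?invr_ge0 //; [lra | lia].
  have -> : 2^-1 ^+ 4 = 16^-1 :> R by lra.
  by nra.
have -> (x : R) : 2 * x = x + x by lra.
apply: lerD; rewrite ler_expR; first by rewrite lerN2.
rewrite natrM.
have : n%:R * (2 * (expR 1 * (2 * (3 / 4) ^+ D))) <= n%:R * eta.
  by rewrite ler_wpM2l.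
by move: (expR 1 * _) kap => c; set z := _ / L.+1%:R; lra.
Qed.

(** If eta n <= 2, then 1 - p <= e^(-p) and p >= p eta n / 2. Otherwise 2 <= e gives 2 e^(-eta n) <=
    e^(1 - eta n) <= e^(-eta n / 2). Both cases yield the rate p eta / 2, whence 142 = 33 + 108 +
    1. *)
Lemma avg_irredundant_le (R : realType) (V : finType) (e : rel V)
    (N n : nat) (X Y : {set V}) :
  (0 < N)%N ->
  simple_graph e -> bipartition e X Y -> #|X| = n -> #|Y| = (2 * n)%N ->
  (N * im e + n < N * n)%N ->
  avg (enum X) (fun A => (irredundant_sub e X A)%:R) set0
  <= expR (- (2^-1 ^+ (142 * N) * n%:R)) :> R.
Proof.
move=> N0 smp bip cX cY ltim.
set p : R := 2^-1 ^+ (33 * N); set eta : R := 2^-1 ^+ (108 * N).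
have hN0 : 0 <= 2^-1 :> R by lra.
have hN1 : 2^-1 <= 1 :> R by lra.
have p0 : 0 < p by rewrite exprn_gt0 ?invr_gt0.
have p1 : p <= 1 by apply: exprn_ile1.
have eta0 : 0 <= eta by rewrite exprn_ge0.
have en0 : 0 <= eta * n%:R by rewrite mulr_ge0.
have le_pe : 2^-1 ^+ (142 * N) * n%:R <= p * (eta * n%:R / 2) :> R.
  have : 2^-1 ^+ (142 * N) <= p * eta * 2^-1.
    by rewrite /p /eta -exprD -exprSr ler_wiXn2l //; lia.
  move/(ler_wpM2r (ler0n R n)); move: (2^-1 ^+ (142 * N)) => c; lra.
have [small|large] := lerP (eta * n%:R) 2.
  apply: le_trans (avg_irredundant_le1B R N0 smp bip cX cY ltim) _.
  rewrite -/p; apply: le_trans (expR_ge1Dx (- p)) _.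
  by rewrite ler_expR lerN2 (le_trans le_pe) // ler_piMr ?(ltW p0) //; lra.
apply: le_trans (avg_irredundant_le_large R N0 smp bip cX cY ltim) _.
have e2 : 2 <= expR 1 :> R by apply: le_trans (expR_ge1Dx _); lra.
apply: (@le_trans _ _ (expR 1 * expR (- (eta * n%:R)))).
  by rewrite ler_wpM2r ?expR_ge0.
rewrite -expRD ler_expR -/eta.
have : p * (eta * n%:R / 2) <= eta * n%:R / 2 by rewrite ler_piMl //; lra.
lra.
Qed.

Theorem theorem4p2 (R : realType) :
  exists2 C : R, 0 < C &
    forall eps : R, 0 < eps ->
      exists2 delta : R, 2 `^ (- (C / eps)) <= delta &
        forall (V : finType) (e : rel V) (X Y : {set V}) (n : nat),
          simple_graph e ->
          bipartition e X Y ->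
          #|X| = n ->
          #|Y| = (2 * n)%N ->
          (im e)%:R < (1 - eps) * n%:R ->
          log2 ((irr e X)%:R) < (1 - delta) * n%:R.
Proof.
(* 284 = 2 * 142, because N <= 2 / eps below. *)
exists 284 => // eps eps0; set delta := 2 `^ _; exists delta => //.
move=> V e X Y n smp bip cX cY ltim.
have n0 : (0 < n)%N.
  by case: n ltim {cX cY} => //; rewrite mulr0 ltrn0.
have nR : 0 < n%:R :> R by rewrite ltr0n.
have eps1 : eps < 1.
  have : 0 < (1 - eps) * n%:R by apply: le_lt_trans ltim.
  by rewrite pmulr_lgt0 // subr_gt0.
(* The least integer above 1 / eps; eps * N > 1 turns the hypothesis on [im e] into an inequality
   between integers. *)
pose N := (Num.truncn eps^-1).+1.
have N_gt0 : (0 < N)%N by [].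
have ltN : eps^-1 < N%:R by apply: truncnS_gt.
have leN : N%:R <= 2 / eps.
  have : (Num.truncn eps^-1)%:R <= eps^-1 by rewrite truncn_le // invr_ge0 ltW.
  have : 1 <= eps^-1 by rewrite invf_ge1 // ltW.
  rewrite /N -natr1; lra.
clearbody N.
have ltim' : (N * im e + n < N * n)%N.
  rewrite -(ltr_nat R) natrD !natrM.
  have hN : 1 < eps * N%:R by rewrite -ltr_pdivrMl // mulr1.
  have N0 : 0 < N%:R :> R by rewrite ltr0n.
  have : N%:R * (im e)%:R < N%:R * ((1 - eps) * n%:R) by rewrite ltr_pM2l.
  have : 1 * n%:R < eps * N%:R * n%:R by rewrite ltr_pM2r.
  lra.
have bound := avg_irredundant_le R N_gt0 smp bip cX cY ltim'.
set d1 : R := 2^-1 ^+ (142 * N) in bound.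
have led : delta <= d1.
  rewrite /d1 exprVn -powR_mulrn // -powRN /delta ler_powR ?ler1n //.
  rewrite lerN2 natrM; lra.
have d0 : 0 < delta by rewrite powR_gt0.
have ln20 : 0 < ln 2 :> R by rewrite ln_gt0 // ltr1n.
have ln21 : ln 2 < 1 :> R.
  rewrite -ltr_expR lnK ?posrE //.
  by have := expR_gt1Dx (oner_neq0 R); lra.
have irr0 : (0 < irr e X)%N.
  by apply/card_gt0P; exists set0; rewrite inE sub0set irredundant0.
rewrite /log2 ltr_pdivrMr //.
(* Strictness comes from ln 2 < 1: the loss d1 n in natural logarithms exceeds delta n ln 2. *)
apply: (@le_lt_trans _ _ (n%:R * ln 2 - d1 * n%:R)); last first.
  have : delta * n%:R * ln 2 < delta * n%:R by rewrite gtr_pMr ?mulr_gt0.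
  have : delta * n%:R <= d1 * n%:R by rewrite ler_pM2r.
  lra.
rewrite -ler_expR lnK ?posrE ?ltr0n // expRD expRM_natl lnK ?posrE //.
by rewrite irrE cX ler_wpM2l ?exprn_ge0.
Qed.
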